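(* For any binary alphabet $\Sigma$, there is no injective morphism $\varphi:\Sigma^*\times\Sigma^*\to{\rm SL}(3,\mathbb{Z})$.
   Context: $\Sigma^*\times\Sigma^*$ is the direct product monoid of pairs of words over $\Sigma$ with componentwise concatenation; a morphism is a map $\varphi$ with $\varphi(xy)=\varphi(x)\varphi(y)$. ${\rm SL}(3,\mathbb{Z})$ is the group (under matrix multiplication) of integer $3\times 3$ matrices of determinant $1$. *)

(* Defs.v *)
From HB Require Import structures.
From mathcomp Require Import all_boot all_order all_algebra.

Set Implicit Arguments.
Unset Strict Implicit.
Unset Printing Implicit Defensive.

Import GRing.Theory.
Local Open Scope ring_scope.

(* The free monoid on Sigma: an alias of seq Sigma, so that concatenation can
   be declared as its multiplication. The monoid structure on pairs of words is
   then the componentwise one that the library puts on products. *)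
Definition word (Sigma : choiceType) : Type := seq Sigma.
HB.instance Definition _ (Sigma : choiceType) := Choice.on (word Sigma).

HB.instance Definition _ (Sigma : choiceType) :=
  isMonoid.Build (word Sigma) (@catA Sigma) (@cat0s Sigma) (@cats0 Sigma).

Record SL (n : nat) (R : comNzRingType) :=
  MkSL { mx_of_SL :> 'M[R]_n; det_SL : \det mx_of_SL == 1 }.

Section SpecialLinearGroup.
Variables (n : nat) (R : comNzRingType).

HB.instance Definition _ := [isSub for @mx_of_SL n R].
HB.instance Definition _ := [Choice of SL n R by <:].

Implicit Types A B C : SL n R.

Fact SL_one_subproof : \det (1%:M : 'M[R]_n) == 1.
Proof. by rewrite det1. Qed.

Fact SL_mul_subproof A B : \det (mx_of_SL A *m mx_of_SL B) == 1.
Proof. by rewrite det_mulmx (eqP (det_SL A)) (eqP (det_SL B)) mulr1. Qed.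

Fact SL_inv_subproof A : \det (\adj (mx_of_SL A)) == 1.
Proof.
have /(congr1 determinant) := mul_mx_adj (mx_of_SL A).
by rewrite det_mulmx det_scalar (eqP (det_SL A)) expr1n mul1r => ->.
Qed.

Definition SL_one : SL n R := MkSL SL_one_subproof.
Definition SL_mul A B : SL n R := MkSL (SL_mul_subproof A B).
(* A matrix of determinant 1 has its adjugate as inverse. *)
Definition SL_inv A : SL n R := MkSL (SL_inv_subproof A).

Fact SL_mulA : associative SL_mul.
Proof. by move=> A B C; apply/val_inj/mulmxA. Qed.

Fact SL_mul1 : left_id SL_one SL_mul.
Proof. by move=> A; apply/val_inj/mul1mx. Qed.

Fact SL_mulr1 : right_id SL_one SL_mul.
Proof. by move=> A; apply/val_inj/mulmx1. Qed.

Fact SL_mulV : left_inverse SL_one SL_inv SL_mul.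
Proof.
by move=> A; apply/val_inj; rewrite /= mul_adj_mx (eqP (det_SL A)).
Qed.

Fact SL_mulrV : right_inverse SL_one SL_inv SL_mul.
Proof.
by move=> A; apply/val_inj; rewrite /= mul_mx_adj (eqP (det_SL A)).
Qed.

HB.instance Definition _ :=
  isGroup.Build (SL n R) SL_mulA SL_mul1 SL_mulr1 SL_mulV SL_mulrV.

End SpecialLinearGroup.

(* Main.v *)
(* Let A, B be the images of the two letters of the first factor, and let X be
   the image of a word of the second one, so that X commutes with A and B.
   If the minimal polynomial of X had degree 3, X would have a cyclic vector and
   its commutant would consist of polynomials in X; but A and B do not commute.
   Since the characteristic polynomial of X is integral with constant term -1
   and has degree 3, its linear cofactor to a quadratic minimal polynomial has
   root 1 or -1, which forces X^2 = 1 or (X - 1)^2 = 0, and the former is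
   excluded by injectivity. Applied to the images C, D and CD of the letters of
   the second factor and of their product, this yields CDDC = DCCD, contradicting
   injectivity. *)

Require Import Defs.
From mathcomp Require Import all_boot all_order all_algebra all_field.

Set Implicit Arguments.
Unset Strict Implicit.
Unset Printing Implicit Defensive.

Import GRing.Theory.
Local Open Scope ring_scope.

(** * Matrices commuting with a matrix that has a cyclic vector *)

Section CyclicVector.

Variables (F : fieldType) (n : nat).
Implicit Types (X : 'M[F]_n.+1) (v : 'rV[F]_n.+1).

(** The size bound makes this the linear independence of [v], [v X], ..., [v X^n]. *)
Definition cyclic_vector X v :=
  forall q : {poly F}, (size q <= n.+1)%N -> v *m horner_mx X q = 0 -> q = 0.

(** The [v X^i] form a basis, so [v A = v P] for some polynomial [P] in [X]; since [A] and [P]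
    commute with [X], they agree on the whole basis. *)
Lemma comm_mx_cyclic_horner X A v :
  cyclic_vector X v -> comm_mx A X -> exists p, A = horner_mx X p.
Proof.
move=> cyc_v cAX; pose K := \matrix_(i < n.+1) (v *m X ^+ i).
have mulK u : u *m K = v *m horner_mx X (rVpoly u).
  rewrite horner_rVpoly mulmx_sum_row [u *m powers_mx _ _]mulmx_sum_row.
  rewrite linear_sum mulmx_sumr /=.
  by apply: eq_bigr => i _; rewrite !rowK linearZ /= mxvecK scalemxAr.
have free_K : row_free K.
  apply/row_freeP/row_freeP/inj_row_free => u.
  by rewrite mulK => /(cyc_v _ (size_poly _ _))/(canRL rVpolyK); rewrite linear0.
have unitK : K \in unitmx by rewrite -row_free_unit.
pose u := v *m A *m invmx K; exists (rVpoly u).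
set P := horner_mx X _.
apply: (can_inj (mulKmx unitK)); apply/row_matrixP => i.
have cP : comm_mx P (X ^+ i) by apply/commrX/comm_horner_mx.
have cA : comm_mx A (X ^+ i) by apply: commrX.
by rewrite !row_mul !rowK -!mulmxA -cA -cP !mulmxA -mulK mulmxKV.
Qed.

Lemma comm_mx_cyclic X A B v :
  cyclic_vector X v -> comm_mx A X -> comm_mx B X -> comm_mx A B.
Proof.
move=> cyc_v /(comm_mx_cyclic_horner cyc_v)[p ->].
by move=> /(comm_mx_cyclic_horner cyc_v)[q ->]; apply: comm_horner_mx2.
Qed.

End CyclicVector.

(** * Existence of cyclic vectors over an algebraically closed field *)

Section ClosedField.

Variables (F : closedFieldType) (n : nat).

(* The vector is taken on the moment curve t |-> (1, t, ..., t^n): along it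
   each condition is the nonvanishing of a nonzero polynomial in t. *)
Lemma exists_row_mul_neq0 (I : eqType) (s : seq I) (M : I -> 'M[F]_n.+1) :
  (forall i, i \in s -> M i != 0) ->
  exists v : 'rV_n.+1, forall i, i \in s -> v *m M i != 0.
Proof.
move=> M_neq0.
have [p p_neq0 rootp] : exists2 p : {poly F}, p != 0 & forall t i, i \in s ->
    (\row_(j < n.+1) t ^+ j) *m M i = 0 -> root p t.
  elim: s M_neq0 => [|i s IHs] M_neq0; first by exists 1; rewrite ?oner_neq0.
  have [j sj|p p_neq0 rootp] := IHs; first by apply: M_neq0; rewrite inE sj orbT.
  have /matrix0Pn[j [k Mjk]] := M_neq0 i (mem_head _ _).
  (* Column [k] of [M i], read as a polynomial, takes at [t] the value of entry [k] of the
     product. *)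
  exists (rVpoly (col k (M i))^T * p).
    rewrite mulf_neq0 //; apply: contra_neq Mjk => /polyP/(_ j).
    by rewrite coef_rVpoly_ord !mxE coef0.
  move=> t l; rewrite rootM inE => /predU1P[->|/rootp IH /IH->]; last first.
    by rewrite orbT.
  move=> /matrixP/(_ 0 k); rewrite !mxE => e; apply/orP; left.
  rewrite rootE /rVpoly horner_poly -[X in _ == X]e; apply/eqP.
  apply: eq_bigr => m _; rewrite insubT // => ?; rewrite !mxE mulrC.
  by congr (_ * M i _ _); apply: val_inj.
have /closed_nonrootP[t not_root_t] := p_neq0.
exists (\row_j t ^+ j) => i /(rootp t) h.
by apply: contra not_root_t => /eqP.
Qed.

(* A polynomial of low degree killing v has with the minimal polynomial m a
   common factor that kills v and divides m / (X - r) for some root r of m; so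
   it is enough that v is killed by none of the m / (X - r). *)
Lemma cyclic_vector_exists (X : 'M[F]_n.+1) :
  (size (mxminpoly X) > n.+1)%N -> exists v, cyclic_vector X v.
Proof.
move=> sz; set m := mxminpoly X in sz *.
have m_neq0 : m != 0 by rewrite monic_neq0 ?mxminpoly_monic.
have [rs def_m] := closed_field_poly_normal m.
rewrite (monicP (mxminpoly_monic X)) scale1r in def_m.
have root_rs r : (r \in rs) = root m r by rewrite def_m root_prod_XsubC.
have [r|v vP] := @exists_row_mul_neq0 _ rs
    (fun r => horner_mx X (m %/ ('X - r%:P))).
  rewrite root_rs -dvdp_XsubCl => dvd_r.
  rewrite -dvd_mxminpoly -/m; apply/negP => /dvdp_leq.
  have : m %/ ('X - r%:P) != 0 by rewrite dvdp_div_eq0.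
  move=> q0 /(_ q0); rewrite size_divp ?polyXsubC_eq0 // size_XsubC.
  by rewrite leqNgt ltn_subrL /= (leq_trans _ sz).
exists v => q sz_q vq0; apply/eqP/contraT => q_neq0.
pose g := gcdp q m.
have vg0 : v *m horner_mx X g = 0.
  have [[a b] /=] := Bezoutp q m; rewrite -/g => /eqpP[[c d] /= /andP[c0 d0]].
  move=> /(congr1 (fun p => v *m horner_mx X p)) /=.
  rewrite linearZ rmorphD !rmorphM /= mx_root_minpoly mulr0 addr0.
  rewrite [_ a * _]comm_horner_mx2 -mulmxE -scalemxAr mulmxA vq0 mul0mx scaler0.
  rewrite linearZ /= -scalemxAr => /esym/eqP.
  by rewrite scaler_eq0 (negPf d0) => /eqP.
have szg : (size g < size m)%N.
  by apply: leq_ltn_trans sz; apply: leq_trans sz_q; apply/dvdp_leq/dvdp_gcdl.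
have dvd_g : g %| m by apply: dvdp_gcdr.
have [r root_r] : exists r, root (m %/ g) r.
  apply/closed_rootP; rewrite neq_ltn; apply/orP; right.
  rewrite size_divp ?gcdp_eq0 ?negb_and ?q_neq0 //.
  by rewrite ltn_subRL addn1 prednK // size_poly_gt0 gcdp_eq0 negb_and q_neq0.
have rm : r \in rs by rewrite root_rs -(divpK dvd_g) rootM root_r.
have /negP[] := vP r rm.
have /factor_theorem[k def_k] := root_r.
have -> : m %/ ('X - r%:P) = g * k.
  have -> : m = g * k * ('X - r%:P) by rewrite -mulrA -def_k mulrC divpK.
  by rewrite mulpK ?polyXsubC_eq0.
by rewrite rmorphM -mulmxE mulmxA vg0 mul0mx.
Qed.

End ClosedField.

(** * Quadratic relations forced by a noncommuting pair in the commutant *)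

Lemma size_mxminpoly_noncomm n (X A B : 'M[rat]_n.+1) :
  comm_mx A X -> comm_mx B X -> ~ comm_mx A B ->
  (size (mxminpoly X) <= n.+1)%N.
Proof.
move=> cAX cBX ncAB; rewrite leqNgt; apply/negP => sz; apply: ncAB.
(* Cyclic vectors are available over [algC], and extending the field keeps the size of the minimal
   polynomial. *)
pose f := map_mx (ratr : rat -> algC).
have [|v cyc_v] := @cyclic_vector_exists _ _ (f _ _ X).
  by rewrite mxminpoly_map size_map_poly.
apply: (@map_mx_inj _ _ (ratr : {rmorphism rat -> algC})); rewrite !map_mxM /=.
apply: (comm_mx_cyclic cyc_v); rewrite /comm_mx /f -!map_mxM /=.
  by rewrite cAX.
by rewrite cBX.
Qed.

(** By Gauss's lemma, a rational multiple of the linear factor at [c] is an integer factor of [p];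
    its two coefficients divide units, so each is 1 or -1. *)
Lemma monic_unit_rat_root (p : {poly int}) (c : rat) :
  p \is monic -> p`_0 \is a GRing.unit -> root (map_poly intr p) c ->
  c = 1 \/ c = -1.
Proof.
move=> mon_p p0; rewrite -dvdp_XsubCl.
move=> /dvdpP_rat_int[s [a a_neq0 def_s] [r def_p]].
have sz_s : size s = 2%N.
  by rewrite -(size_rat_int_poly s) -(size_scale _ a_neq0) -def_s size_XsubC.
have s0 : s`_0 \is a GRing.unit.
  by move: p0; rewrite def_p coef0M unitrM => /andP[].
have s1 : s`_1 \is a GRing.unit.
  move/monicP: mon_p; rewrite def_p lead_coefM lead_coefE sz_s /= => e.
  by have := unitr1 int; rewrite -e unitrM => /andP[].
move/polyP: def_s => def_s; have := def_s 1%N; have := def_s 0%N.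
rewrite !coefB !coefX !coefC !coefZ !coef_map /= subr0 sub0r => e0 e1.
have unit_int (x : int) : x \is a GRing.unit -> x = 1 \/ x = -1.
  by move=> /orP[] /eqP; [left|right].
move: e0 e1 => /(canRL (@opprK _)) ->.
case: (unit_int _ s0) (unit_int _ s1) => -> [] -> //= /esym;
  rewrite ?mulr1 ?rmorphN1 ?mulrN1.
- by move=> ->; right.
- by move=> /(canRL (@opprK _)) ->; left.
- by move=> ->; left.
- by move=> /(canRL (@opprK _)) ->; right.
Qed.

Lemma monic_size2 (R : nzRingType) (p : {poly R}) :
  p \is monic -> size p = 2%N -> exists c, p = 'X - c%:P.
Proof.
move=> /monicP; rewrite lead_coefE => + sz; rewrite sz /= => p1.
exists (- p`_0); apply/polyP => i; rewrite coefB coefX coefC.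
case: i => [|[|i]]; rewrite ?p1 /= ?subr0 ?sub0r ?opprK //.
by rewrite nth_default ?sz.
Qed.

Lemma map_intr_mx_inj m n :
  injective (map_mx (intr : int -> rat) : 'M_(m, n) -> 'M_(m, n)).
Proof.
move=> M N /matrixP eMN; apply/matrixP => i j.
by have := eMN i j; rewrite !mxE => /intr_inj.
Qed.

Lemma quadratic_int_mx3 (X A B : 'M[int]_3) :
    \det X = 1 -> comm_mx A X -> comm_mx B X -> ~ comm_mx A B ->
  X ^+ 2 = 1 \/ (X - 1) ^+ 2 = 0.
Proof.
move=> detX cAX cBX ncAB.
set XQ := map_mx (intr : int -> rat) X.
have szm : (size (mxminpoly XQ) <= 3)%N.
  apply: (@size_mxminpoly_noncomm _ XQ (map_mx intr A) (map_mx intr B)).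
  - by rewrite /comm_mx /XQ -!map_mxM cAX.
  - by rewrite /comm_mx /XQ -!map_mxM cBX.
  - by rewrite /comm_mx -!map_mxM => /map_intr_mx_inj.
have chi0 : (char_poly X)`_0 = -1.
  by rewrite char_poly_det detX mulr1 -signr_odd.
have chiQ : char_poly XQ = map_poly intr (char_poly X) by rewrite map_char_poly.
have root1 c : root (char_poly XQ) c -> c = 1 \/ c = -1.
  rewrite chiQ; apply: monic_unit_rat_root; first exact: char_poly_monic.
  by rewrite chi0 unitrN1.
have sq1 (c : rat) : c = 1 \/ c = -1 -> c * c = 1.
  by case=> ->; rewrite ?mulr1 ?mulrNN.
have mon_m := mxminpoly_monic XQ.
have: (1 < size (mxminpoly XQ))%N.
  by rewrite size_mxminpoly ltnS mxminpoly_nonconstant.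
(* If the minimal polynomial is linear, the matrix is a scalar [c] with [c^2 = 1]. *)
rewrite leq_eqVlt => /predU1P[/esym sz2|sz3].
  have [c def_m] := monic_size2 mon_m sz2.
  have /root1/sq1 cc : root (char_poly XQ) c.
    by rewrite -root_mxminpoly def_m root_XsubC.
  have := mx_root_minpoly XQ.
  rewrite def_m rmorphB /= horner_mx_X horner_mx_C => /subr0_eq XQc.
  left; apply: map_intr_mx_inj; rewrite expr2 map_mxM map_mx1 -/XQ XQc.
  by rewrite -scalar_mxM cc.
have {szm sz3} sz3 : size (mxminpoly XQ) = 3 by apply/eqP; rewrite eqn_leq szm.
have /dvdpP[q def_chi] := mxminpoly_dvd_char XQ.
have mon_q : q \is monic.
  by rewrite -(monicMr _ mon_m) -def_chi char_poly_monic.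
have sz_q : size q = 2%N.
  have := size_char_poly XQ.
  by rewrite def_chi size_Mmonic ?monic_neq0 // sz3 addnC => -[].
have [c def_q] := monic_size2 mon_q sz_q.
have rc : root (char_poly XQ) c by rewrite def_chi def_q rootM root_XsubC eqxx.
have := rc; rewrite -root_mxminpoly -dvdp_XsubCl => /dvdpP[r def_m].
have mon_r : r \is monic.
  by rewrite -(monicMr _ (monicXsubC c)) -def_m.
have sz_r : size r = 2%N.
  have := sz3; rewrite def_m size_Mmonic ?monic_neq0 ?monicXsubC //.
  by rewrite size_XsubC addn2 => -[].
have [d def_r] := monic_size2 mon_r sz_r.
(* The characteristic polynomial is [(t - c)^2 (t - d)]; as [c^2 = 1], its constant term -1 equals
   [-d]. *)
have d1 : d = 1.
  have := congr1 (fun p : {poly rat} => p`_0) def_chi.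
  rewrite chiQ coef_map chi0 def_m def_q def_r !coef0M !coefB !coefX !coefC /=.
  rewrite !sub0r mulrNN mulNr mulrCA sq1 ?mulr1; last exact: root1.
  by rewrite rmorphN1 => /oppr_inj.
have := mx_root_minpoly XQ; rewrite def_m def_r d1.
rewrite rmorphM !rmorphB /= horner_mx_X !horner_mx_C => XX0.
case: (root1 c rc) XX0 => ->; rewrite ?rmorphN ?rmorph1 /= ?opprK => XX0.
  right; apply: map_intr_mx_inj.
  by rewrite expr2 map_mxM map_mxB map_mx1 map_mx0.
left; apply: map_intr_mx_inj; apply/eqP.
rewrite -subr_eq0 -map_mxB -(expr1n _ 2) subr_sqr_1.
by rewrite map_mxM map_mxB map_mxD map_mx1; apply/eqP.
Qed.

(** * Square-zero perturbations of 1, and the contradiction on words *)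

Lemma sqr0_mulCDDC (R : nzRingType) (C D : R) :
    (C - 1) ^+ 2 = 0 -> (D - 1) ^+ 2 = 0 -> (C * D - 1) ^+ 2 = 0 ->
  C * D * D * C = D * C * C * D.
Proof.
(* With [C = 1 + N] and [D = 1 + M], the two sides expand to sums that differ only in [2NMN] against
   [2MNM]. *)
have -> : C = 1 + (C - 1) by rewrite addrC subrK.
have -> : D = 1 + (D - 1) by rewrite addrC subrK.
move: (C - 1) (D - 1) => N M; rewrite ![1 + _ - 1]addrAC !subrr !add0r !expr2.
move=> NN MM; have -> : (1 + N) * (1 + M) - 1 = N + M + N * M.
  rewrite mulrDl mul1r mulrDr mulr1 -[1 + M + _]addrA [LHS]addrC addKr.
  by rewrite addrA (addrC M).
move=> E.
have NNx x : N * (N * x) = 0 by rewrite mulrA NN mul0r.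
have MMx x : M * (M * x) = 0 by rewrite mulrA MM mul0r.
(* Multiplying [E] by [N] on the left, then by [M] on the right, leaves [NMN] and [MNM], each plus
   the same [NMNM]. *)
have E1 : N * (M * N) + N * (M * (N * M)) = 0.
  have := congr1 ( *%R N) E; rewrite mulr0 => <-.
  by rewrite !(mulrDl, mulrDr) -!mulrA !(NN, MM, NNx, MMx, mulr0, add0r, addr0).
have E2 : M * (N * M) + N * (M * (N * M)) = 0.
  have := congr1 ( *%R^~ M) E; rewrite mul0r => <-.
  by rewrite !(mulrDl, mulrDr) -!mulrA !(NN, MM, NNx, MMx, mulr0, add0r, addr0).
have NMN : N * (M * N) = M * (N * M).
  by apply: (addIr (N * (M * (N * M)))); rewrite E1 E2.
rewrite !(mulrDl, mulrDr, mul1r, mulr1) -!mulrA.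
rewrite !(NN, MM, NNx, MMx, mulr0, add0r, addr0) NMN.
(* Only the order of the eleven summands still differs. *)
by rewrite [LHS](AC (2*2*2*(3*2)) ((1*3)*(2*8)*(7*10)*(5*4*9*(6*11)))).
Qed.

Local Close Scope ring_scope.

Theorem theorem10 (Sigma : finType) (hSigma : #|Sigma| = 2) :
  ~ exists phi : {multiplicative word Sigma * word Sigma -> SL 3 int},
      injective phi.
Proof.
move=> [phi phi_inj].
have /card_gt1P[a [b [_ _ neq_ab]]] : 1 < #|Sigma| by rewrite hSigma.
pose f (u v : word Sigma) : 'M[int]_3 := phi (u, v).
have f_inj u v u' v' : f u v = f u' v' -> (u, v) = (u', v').
  by move=> /val_inj/phi_inj.
have fM (u v u' v' : word Sigma) : f (u ++ u') (v ++ v') = (f u v * f u' v')%R.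
  by rewrite -[LHS]/(mx_of_SL (phi ((u, v) * (u', v'))%g)) gmulfM.
have quadratic w : w != [::] -> ((f [::] w - 1) ^+ 2 = 0)%R.
  move=> w_neq0; have detw : (\det (f [::] w) = 1)%R by apply/eqP/det_SL.
  have commw x : comm_mx (f [:: x] [::]) (f [::] w).
    by rewrite /comm_mx mulmxE -!fM !cats0.
  have ncomm : ~ comm_mx (f [:: a] [::]) (f [:: b] [::]).
    rewrite /comm_mx mulmxE -!fM => /f_inj[] eab.
    by rewrite eab eqxx in neq_ab.
  have [|//] := quadratic_int_mx3 detw (commw a) (commw b) ncomm.
  (* [phi] is only known to respect products; the image of the empty pair is idempotent and
     invertible, hence 1. *)
  have : f [::] [::] = 1%R.
    apply: (@mulIr _ (f [::] [::])); last by rewrite -fM mul1r.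
    rewrite -[_ \is a _]/(_ \in unitmx) unitmxE.
    by rewrite (eqP (det_SL _)) unitr1.
  rewrite expr2 -fM => <- /f_inj[ww0].
  by move: w_neq0; case: (w) ww0.
(* [quadratic] is applied to the words [a], [b] and [ab]. *)
have e : f [::] [:: a; b; b; a] = f [::] [:: b; a; a; b].
  pose g x := f [::] [:: x].
  have gE x y z t : f [::] [:: x; y; z; t] = (g x * g y * g z * g t)%R.
    by rewrite -!fM.
  rewrite !gE; apply: sqr0_mulCDDC; rewrite -?fM; exact: quadratic.
have [eab _ _ _] := f_inj _ _ _ _ e.
by rewrite eab eqxx in neq_ab.
Qed.
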